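(* Let $N\ge 2$ and $i\in\{1,\dots,N-1\}$. Let $\alpha_1,\dots,\alpha_N>0$, let $\beta_j\ge 0$ for $j\in\{1,\dots,N-1\}\setminus\{i\}$, with the boundary conventions $\alpha_0=\alpha_{N+1}=0$, $\beta_0=\beta_N=0$, and let $d>0$. Let $\hat\mu_j$ and $\hat\Sigma_{jj}$ be the posterior means and variances defined in the context. If $c>1$, then the equation in the unknown $\beta_i$ $$\frac{c-1}{\beta_i}-d+\frac12\left(\frac{\alpha_{i+1}}{\alpha_i+\beta_{i-1}\alpha_{i-1}+\beta_i\alpha_{i+1}}+\frac{\alpha_i}{\alpha_{i+1}+\beta_i\alpha_i+\beta_{i+1}\alpha_{i+2}}\right)-\frac12\left[\alpha_{i+1}\left(\hat\mu_i^2+\hat\Sigma_{ii}\right)+\alpha_i\left(\hat\mu_{i+1}^2+\hat\Sigma_{i+1,i+1}\right)\right]=0$$ has exactly one positive real root.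
   Context: The equation is the first-order stationarity condition in $\beta_i$ of the EM objective for the following model. Observations $\mathbf{y}=\boldsymbol{\Phi}\mathbf{x}+\mathbf{n}$ with $\mathbf{y}\in\mathbb{R}^M$, $\boldsymbol{\Phi}\in\mathbb{R}^{M\times N}$, and Gaussian noise $\mathbf{n}\sim\mathcal{N}(0,\gamma^{-1}\mathbf{I})$. The prior on $\mathbf{x}\in\mathbb{R}^N$ has independent components $x_j\sim\mathcal{N}\big(0,(\alpha_j+\beta_{j-1}\alpha_{j-1}+\beta_j\alpha_{j+1})^{-1}\big)$. The coupling parameters $\beta_1,\dots,\beta_{N-1}$ have independent Gamma priors with shape $c$ and rate $d$, i.e. density proportional to $\beta^{c-1}e^{-d\beta}$ on $\beta>0$. The posterior moments are computed from the previous iterates, which are fixed real parameters $\bar\alpha_1,\dots,\bar\alpha_N>0$, $\bar\beta_1,\dots,\bar\beta_{N-1}\ge 0$, $\bar\gamma>0$ (with $\bar\alpha_0=\bar\alpha_{N+1}=\bar\beta_0=\bar\beta_N=0$) that do not depend on the unknown $\beta_i$: $$\hat{\boldsymbol{\Sigma}}=\left(\bar\gamma\,\boldsymbol{\Phi}^T\boldsymbol{\Phi}+\boldsymbol{\Lambda}\right)^{-1},\qquad \hat{\boldsymbol{\mu}}=\bar\gamma\,\hat{\boldsymbol{\Sigma}}\boldsymbol{\Phi}^T\mathbf{y},$$ where $\boldsymbol{\Lambda}$ is the diagonal matrix with $j$-th diagonal entry $\bar\alpha_j+\bar\beta_{j-1}\bar\alpha_{j-1}+\bar\beta_j\bar\alpha_{j+1}$.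 Here $\hat\mu_j$ is the $j$-th entry of $\hat{\boldsymbol{\mu}}$ and $\hat\Sigma_{jj}$ the $(j,j)$ entry of $\hat{\boldsymbol{\Sigma}}$. *)

(* Defs.v *)
From HB Require Import structures.
From mathcomp Require Import all_boot all_order all_algebra.
From mathcomp Require Import reals.

Set Implicit Arguments.
Unset Strict Implicit.
Unset Printing Implicit Defensive.

Import Order.TTheory GRing.Theory Num.Theory.

Local Open Scope ring_scope.

(* Parameter families are functions on nat with 1-based indices, so that the
   boundary values alpha_0, alpha_(N+1), beta_0, beta_N are ordinary values;
   coordinate j of a vector in R^N is the ordinal of value j - 1. *)

(* Precision of x_j under the pattern-coupled Gaussian prior; meant for j >= 1. *)
Definition prior_precision (R : realType) (alpha beta : nat -> R) (j : nat) : R :=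
  alpha j + beta j.-1 * alpha j.-1 + beta j * alpha j.+1.

Definition prior_precision_mx (R : realType) (N : nat) (alpha beta : nat -> R) :
    'M[R]_N :=
  diag_mx (\row_(k < N) prior_precision alpha beta k.+1).

Definition posterior_cov (R : realType) (M N : nat) (Phi : 'M[R]_(M, N))
    (alpha beta : nat -> R) (gamma : R) : 'M[R]_N :=
  invmx (gamma *: (Phi^T *m Phi) + prior_precision_mx N alpha beta).

Definition posterior_mean (R : realType) (M N : nat) (Phi : 'M[R]_(M, N))
    (y : 'cV[R]_M) (alpha beta : nat -> R) (gamma : R) : 'cV[R]_N :=
  gamma *: (posterior_cov Phi alpha beta gamma *m Phi^T *m y).

(* Main.v *)
Require Import Defs.
From HB Require Import structures.
From mathcomp Require Import all_boot all_order all_algebra.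
From mathcomp Require Import reals.
From mathcomp Require Import ring.

(** Only two facts about the posterior moments matter: they do not involve the
    unknown [b], and the variances are nonnegative.  The second holds because
    the posterior precision matrix is positive semidefinite, and then so is its
    inverse ([invmx_diag_ge0]).  The equation thus reads
      [(c - 1) / b + 2^-1 * (u / (p + b * u) + v / (q + b * v)) = K]
    with [u, v, p, q > 0], where [K >= d > 0] collects the terms free of [b].

    As [c > 1], the left-hand side is strictly decreasing on [b > 0]
    ([stationarity_decr]), so there is at most one root.  It tends to [+oo] at
    [0], and, since [u / (p + b * u) <= 1 / b], it is at most [c / b] and hence
    at most [K] at [b = c / K].  An intermediate value argument on the
    polynomial obtained by clearing denominators gives a root
    ([stationarity_root]). *)

Set Implicit Arguments.
Unset Strict Implicit.
Unset Printing Implicit Defensive.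

Import Order.TTheory GRing.Theory Num.Theory.

Local Open Scope ring_scope.

Lemma mx_quad_gram_ge0 (R : realType) (M N : nat) (Phi : 'M[R]_(M, N))
    (v : 'rV[R]_N) :
  0 <= (v *m (Phi^T *m Phi) *m v^T) 0 0.
Proof.
have -> : v *m (Phi^T *m Phi) *m v^T = (v *m Phi^T) *m (v *m Phi^T)^T.
  by rewrite trmx_mul trmxK !mulmxA.
by rewrite mxE sumr_ge0 // => j _; rewrite [X in _ * X]mxE -expr2 sqr_ge0.
Qed.

Lemma mx_quad_diag_ge0 (R : realType) (N : nat) (w v : 'rV[R]_N) :
  (forall j, 0 <= w 0 j) -> 0 <= (v *m diag_mx w *m v^T) 0 0.
Proof.
move=> w0; rewrite mxE sumr_ge0 // => j _.
by rewrite mul_mx_diag !mxE mulrAC -expr2 mulr_ge0 ?sqr_ge0.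
Qed.

(** If [S] is the inverse of [A], then [S *m A *m S^T = S^T], so each diagonal
    entry of [S] is the value of the quadratic form of [A] at a row of [S].  If
    [A] is singular, [invmx A] is [A], whose diagonal entries are the values at
    the unit vectors. *)
Lemma invmx_diag_ge0 (R : realType) (N : nat) (A : 'M[R]_N) (k : 'I_N) :
  (forall v : 'rV[R]_N, 0 <= (v *m A *m v^T) 0 0) -> 0 <= invmx A k k.
Proof.
move=> A0; have [uA | nuA] := boolP (A \in unitmx); last first.
  rewrite /invmx (negbTE nuA); have := A0 (delta_mx 0 k).
  by rewrite -rowE trmx_delta -colE !mxE.
suff -> : invmx A k k = (row k (invmx A) *m A *m (row k (invmx A))^T) 0 0.
  exact: A0.
by rewrite -row_mul mulVmx // tr_row -row_mul mul1mx !mxE.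
Qed.

Lemma ge0_of_zero_boundary (R : realType) (n : nat) (u : nat -> R) :
  u 0%N = 0 -> u n.+1 = 0 -> (forall j, (1 <= j <= n)%N -> 0 <= u j) ->
  forall j, (j <= n.+1)%N -> 0 <= u j.
Proof.
move=> u0 un uge [|j] jn; first by rewrite u0.
by move: jn; rewrite leq_eqVlt => /orP[/eqP-> | jn]; rewrite ?un // uge.
Qed.

(** The two denominators of the equation are affine in [b] with slopes [u], [v]
    and intercepts [p], [q]. *)
Definition stationarity_lhs (R : realType) (c u v p q b : R) : R :=
  (c - 1) / b + 2^-1 * (u / (p + b * u) + v / (q + b * v)).

Lemma stationarity_decr (R : realType) (c u v p q : R) :
  1 < c -> 0 < u -> 0 < v -> 0 < p -> 0 < q ->
  forall b b', 0 < b -> b < b' ->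
  stationarity_lhs c u v p q b' < stationarity_lhs c u v p q b.
Proof.
move=> c1 u0 v0 p0 q0 b b' b0 bb'; have b'0 := lt_trans b0 bb'.
have frac (w r : R) : 0 < w -> 0 < r -> w / (r + b' * w) <= w / (r + b * w).
  move=> w0 r0.
  rewrite ler_pM2l // lef_pV2 ?posrE ?addr_gt0 ?mulr_gt0 //.
  by rewrite lerD2l ler_pM2r // ltW.
rewrite /stationarity_lhs ltr_leD //.
  by rewrite ltr_pM2l ?subr_gt0 // ltf_pV2 ?posrE.
by rewrite ler_pM2l ?invr_gt0 ?ltr0n // lerD // frac.
Qed.

Lemma stationarity_root (R : realType) (c u v p q K : R) :
  1 < c -> 0 < u -> 0 < v -> 0 < p -> 0 < q -> 0 < K ->
  exists2 b, 0 < b & stationarity_lhs c u v p q b = K.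
Proof.
move=> c1 u0 v0 p0 q0 K0; have c0 : 0 < c := lt_trans ltr01 c1.
pose D1 : {poly R} := p%:P + u *: 'X; pose D2 : {poly R} := q%:P + v *: 'X.
(* [P.[b]] is [b * D1.[b] * D2.[b]] times the difference of [K] and the
   left-hand side at [b]. *)
pose P := K *: ('X * D1 * D2) - (c - 1) *: (D1 * D2)
          - 2^-1 *: ('X * (u *: D2 + v *: D1)).
have PE b : P.[b] = K * (b * (p + u * b) * (q + v * b))
    - (c - 1) * ((p + u * b) * (q + v * b))
    - 2^-1 * (b * (u * (q + v * b) + v * (p + u * b))).
  by rewrite /P /D1 /D2 !hornerE.
have P0 : P.[0] < 0.
  rewrite PE !(mulr0, mul0r, addr0, sub0r, subr0) oppr_lt0.
  by rewrite !mulr_gt0 // subr_gt0.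
have B0 : 0 < c / K by rewrite divr_gt0.
have PB : 0 <= P.[c / K].
  (* With [K * b = c] all that is left is [D1 * D2] minus half of
     [(b * u) * D2 + (b * v) * D1], where [b * u <= D1] and [b * v <= D2]. *)
  rewrite PE; set b := c / K in B0 *.
  have -> : c = K * b by rewrite /b mulrC divfK ?gt_eqF.
  have -> : K * (b * (p + u * b) * (q + v * b))
      - (K * b - 1) * ((p + u * b) * (q + v * b))
      - 2^-1 * (b * (u * (q + v * b) + v * (p + u * b)))
      = 2^-1 * (p * (q + v * b) + q * (p + u * b)) by field.
  have D_ge0 (r w : R) : 0 < r -> 0 < w -> 0 <= r + w * b.
    by move=> r0 w0; rewrite ltW // addr_gt0 // mulr_gt0.
  rewrite mulr_ge0 ?invr_ge0 ?ler0n // addr_ge0 // mulr_ge0 ?D_ge0 //; exact: ltW.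
have [b] := poly_ivt (ltW B0) (introT andP (conj (ltW P0) PB)).
move=> /andP[b_ge0 _] /rootP Pb.
have b0 : 0 < b.
  rewrite lt_def b_ge0 andbT; apply: contraTneq P0 => b_eq0.
  by rewrite -[X in P.[X]]b_eq0 Pb ltxx.
exists b => //.
have D1n : p + b * u != 0 by rewrite gt_eqF // addr_gt0 // mulr_gt0.
have D2n : q + b * v != 0 by rewrite gt_eqF // addr_gt0 // mulr_gt0.
have bn : b != 0 by rewrite gt_eqF.
apply/eqP; rewrite eq_sym -subr_eq0.
have -> : K - stationarity_lhs c u v p q b
    = P.[b] / (b * (p + b * u) * (q + b * v)).
  by rewrite PE /stationarity_lhs; field; rewrite bn D1n D2n.
by rewrite Pb mul0r.
Qed.

Theorem theorem1 (R : realType) (M N : nat) (hN : (2 <= N)%N)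
    (* observation model and previous iterates *)
    (Phi : 'M[R]_(M, N)) (y : 'cV[R]_M)
    (alphabar betabar : nat -> R) (gammabar : R)
    (halphabar : forall j : nat, (1 <= j <= N)%N -> 0 < alphabar j)
    (halphabar0 : alphabar 0%N = 0) (halphabarN : alphabar N.+1 = 0)
    (hbetabar : forall j : nat, (1 <= j <= N.-1)%N -> 0 <= betabar j)
    (hbetabar0 : betabar 0%N = 0) (hbetabarN : betabar N = 0)
    (hgammabar : 0 < gammabar)
    (* current parameters; the value [beta i] is not used *)
    (i : nat) (hi : (1 <= i <= N.-1)%N)
    (alpha beta : nat -> R)
    (halpha : forall j : nat, (1 <= j <= N)%N -> 0 < alpha j)
    (halpha0 : alpha 0%N = 0) (halphaN : alpha N.+1 = 0)
    (hbeta : forall j : nat, (1 <= j <= N.-1)%N -> j != i -> 0 <= beta j)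
    (hbeta0 : beta 0%N = 0) (hbetaN : beta N = 0)
    (c d : R) (hd : 0 < d) (hc : 1 < c)
    (* the ordinals of the coordinates i and i + 1 *)
    (k l : 'I_N) (hk : k.+1 = i) (hl : l.+1 = i.+1) :
  let mu := posterior_mean Phi y alphabar betabar gammabar in
  let Sigma := posterior_cov Phi alphabar betabar gammabar in
  exists! b : R,
    0 < b /\
    (c - 1) / b - d
    + 2^-1 * (alpha i.+1 / (alpha i + beta i.-1 * alpha i.-1 + b * alpha i.+1)
              + alpha i / (alpha i.+1 + b * alpha i + beta i.+1 * alpha i.+2))
    - 2^-1 * (alpha i.+1 * (mu k 0 ^+ 2 + Sigma k k)
              + alpha i * (mu l 0 ^+ 2 + Sigma l l)) = 0.
Proof.
case: N => // n in hN Phi hi halphabar halphabarN hbetabar hbetabarN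
  halpha halphaN hbeta hbetaN k l hk hl *.
rewrite /= in hbetabar hi hbeta; move=> mu Sigma.
have abar_ge0 := ge0_of_zero_boundary halphabar0 halphabarN
  (fun j hj => ltW (halphabar j hj)).
have bbar_ge0 := ge0_of_zero_boundary hbetabar0 hbetabarN hbetabar.
have a_ge0 := ge0_of_zero_boundary halpha0 halphaN
  (fun j hj => ltW (halpha j hj)).
have b_ge0 j : (j <= n.+1)%N -> j != i -> 0 <= beta j.
  case: j => [|j] jn ji; first by rewrite hbeta0.
  move: jn; rewrite leq_eqVlt => /orP[/eqP-> | jn]; first by rewrite hbetaN.
  exact: hbeta.
have Sigma_ge0 j : 0 <= Sigma j j.
  apply: invmx_diag_ge0 => v; rewrite mulmxDr mulmxDl mxE addr_ge0 //.
    by rewrite -scalemxAr -scalemxAl mxE mulr_ge0 ?mx_quad_gram_ge0 // ltW.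
  apply: mx_quad_diag_ge0 => m; rewrite mxE /prior_precision /=.
  have m_lt := ltn_ord m; have m_le := ltnW m_lt.
  by rewrite !addr_ge0 ?mulr_ge0 ?abar_ge0 ?bbar_ge0 // ?(leqW m_lt) ?(leqW m_le).
case/andP: hi => i_gt0 i_le.
have ai : 0 < alpha i by rewrite halpha // i_gt0 leqW.
have ai1 : 0 < alpha i.+1 by rewrite halpha.
have p_gt0 : 0 < alpha i + beta i.-1 * alpha i.-1.
  have le1 : (i.-1 <= n.+1)%N by rewrite (leq_trans (leq_pred i)) ?leqW.
  rewrite ltr_wpDr // mulr_ge0 ?a_ge0 ?b_ge0 //; last exact: leqW.
  by rewrite neq_ltn ltn_predL i_gt0.
have q_gt0 : 0 < alpha i.+1 + beta i.+1 * alpha i.+2.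
  by rewrite ltr_wpDr // mulr_ge0 ?a_ge0 ?b_ge0 // neq_ltn ltnSn orbT.
set E := alpha i.+1 * (mu k 0 ^+ 2 + Sigma k k)
  + alpha i * (mu l 0 ^+ 2 + Sigma l l).
have K_gt0 : 0 < d + 2^-1 * E.
  rewrite ltr_wpDr // mulr_ge0 ?invr_ge0 ?ler0n //.
  by rewrite addr_ge0 ?mulr_ge0 ?addr_ge0 ?sqr_ge0 // ltW.
set p := alpha i + _ in p_gt0 *; set q := alpha i.+1 + _ in q_gt0 *.
pose f := stationarity_lhs c (alpha i.+1) (alpha i) p q.
have eqE b : (c - 1) / b - d
    + 2^-1 * (alpha i.+1 / (p + b * alpha i.+1)
        + alpha i / (alpha i.+1 + b * alpha i + beta i.+1 * alpha i.+2))
    - 2^-1 * E = f b - (d + 2^-1 * E).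
  rewrite [alpha i.+1 + b * _ + _]addrAC -/q /f /stationarity_lhs.
  by rewrite opprD addrA [X in X - _ = _]addrAC.
have decr := stationarity_decr hc ai1 ai p_gt0 q_gt0.
have [b b_gt0 fb] := stationarity_root hc ai1 ai p_gt0 q_gt0 K_gt0.
exists b; split; first by split=> //; rewrite eqE /f fb subrr.
move=> b' [b'_gt0]; rewrite eqE => /eqP; rewrite subr_eq0 => /eqP fb'.
case: (ltgtP b b') => // [lt_bb' | lt_b'b].
  by have := decr _ _ b_gt0 lt_bb'; rewrite fb -/(f b') fb' ltxx.
by have := decr _ _ b'_gt0 lt_b'b; rewrite fb -/(f b') fb' ltxx.
Qed.
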